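(* Let $\mu=(\mu_1,\dots,\mu_r)$ be a composition of $n$ and $\pi=[\pi_1|\cdots|\pi_r]$ a $\mu$-involution. Then the $B$-orbit $\mathscr{O}^\pi\subset\mathcal{X}_n$ contains a $T$-fixed point if and only if $\pi$ is a barred permutation. Moreover, in this case the torus fixed point is the distinguished complete quadric $Q_\pi$.
   Context: Let $k$ be the base field, $G=SL_n(k)$, $B\subset G$ the Borel subgroup of upper triangular matrices and $T\subset B$ the maximal torus of diagonal matrices. The variety of complete quadrics $\mathcal{X}_n$ is the wonderful compactification (De Concini–Procesi) of the homogeneous space $SL_n/SO_n$, i.e. of the space of nonsingular quadric hypersurfaces in $\mathbb{P}^{n-1}$, with its natural $G$-action. A point of $\mathcal{X}_n$ can be thought of as a complete quadric: a partial flag $0=V_0\subset V_1\subset\dots\subset V_r=k^n$ together with a nondegenerate quadric on (the projectivization of) each successive quotient $V_j/V_{j-1}$. A composition of $n$ is a sequence $\mu=(\mu_1,\dots,\mu_r)$ of positive integers with sum $n$. A $\mu$-involution is a permutation of $[n]$ in one-line notation cut into consecutive strings $\pi=[\pi_1|\dots|\pi_r]$ with $\pi_j$ of length $\mu_j$, such that each $\pi_j$ is an involution when read as the one-line notation of a permutation of its own alphabet $\mathcal{A}_j$ (the set of its letters, in natural order). The distinguished complete quadric $Q_\pi$ is: $V_j$ is spanned by the standard basis vectors $e_a$ with $a\in\mathcal{A}_1\cup\dots\cup\mathcal{A}_j$, and the quadric on $V_j/V_{j-1}$ is $\sum x_{a}x_{b}+\sum x_{c}^2$, summed over the two-cycles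 $(a,b)$ and one-cycles $(c)$ of $\pi_j$. The $B$-orbits in $\mathcal{X}_n$ are parametrized by the $\mu$-involutions, $\mu$ ranging over the compositions of $n$; $\mathscr{O}^\pi$ is the $B$-orbit indexed by $\pi$, i.e. the one containing $Q_\pi$. A barred permutation is a $\mu$-involution $\pi$, for a composition $\mu$ all of whose parts are at most $2$, such that every string of length two is of the form $ji$ with $j>i$. *)

(* Defs.v *)
From HB Require Import structures.
From mathcomp Require Import all_boot all_order all_algebra.
From mathcomp Require Import ring.

Set Implicit Arguments.
Unset Strict Implicit.
Unset Printing Implicit Defensive.

Import GRing.Theory.
Local Open Scope ring_scope.

Section SpecialLinear.

Variables (k : fieldType) (n : nat).

Definition SL := {g : 'M[k]_n | \det g == 1}.

(** [is_trig_mx] means lower triangular. *)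
Definition borel (g : SL) : bool := is_trig_mx (val g)^T.

Definition torus (g : SL) : bool := is_diag_mx (val g).

Lemma SL_unit (g : SL) : val g \in unitmx.
Proof. by rewrite unitmxE (eqP (valP g)) unitr1. Qed.

Definition SL_one : SL :=
  exist (fun g : 'M[k]_n => is_true (\det g == 1)) 1%:M (introT eqP (det1 k n)).

Lemma SL_mul_proof (g h : SL) : \det (val g *m val h) == 1.
Proof. by rewrite det_mulmx (eqP (valP g)) (eqP (valP h)) mulr1. Qed.

Definition SL_mul (g h : SL) : SL :=
  exist (fun g : 'M[k]_n => is_true (\det g == 1)) _ (SL_mul_proof g h).

End SpecialLinear.

Section CompleteQuadrics.

Variables (k : fieldType) (n : nat).

Local Notation V := 'cV[k]_n.

(** [A] need not be symmetric; two matrices may define the same form. *)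
Definition qform (A : 'M[k]_n) (v : V) : k := (v^T *m A *m v) 0 0.

Definition polar (A : 'M[k]_n) (u v : V) : k :=
  qform A (u + v) - qform A u - qform A v.

(** A quadratic form on [W / U], for [U <= W], is given by a form on the whole
    of [k^n] whose restriction to [W] is constant on the cosets of [U]; what it
    does outside [W] is irrelevant and is forgotten by [same_quadric].
    Nondegeneracy is that of the polar form, hence the usual notion away from
    characteristic 2. *)
Definition descends (U W : {vspace V}) (A : 'M[k]_n) : Prop :=
  forall u w, u \in U -> w \in W -> qform A (w + u) = qform A w.

Definition nondegenerate (U W : {vspace V}) (A : 'M[k]_n) : Prop :=
  forall v, v \in W -> (forall w, w \in W -> polar A v w = 0) -> v \in U.

(** Quadrics, as opposed to quadratic forms: forms up to a nonzero scalar. *)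
Definition same_quadric (W : {vspace V}) (A A' : 'M[k]_n) : Prop :=
  exists2 c : k, c != 0 & forall w, w \in W -> qform A w = c * qform A' w.

(** Only [cq_flag 0], ..., [cq_flag cq_len] and [cq_form 0], ...,
    [cq_form cq_len.-1] are meaningful; [cq_form j] is the quadric on
    [cq_flag j.+1 / cq_flag j]. *)
Record complete_quadric := CompleteQuadric {
  cq_len : nat;
  cq_flag : nat -> {vspace V};
  cq_form : nat -> 'M[k]_n;
  cq_flag0 : cq_flag 0 = 0%VS;
  cq_flag_full : cq_flag cq_len = fullv;
  cq_flag_sub : forall j, (j < cq_len)%N -> (cq_flag j <= cq_flag j.+1)%VS;
  cq_flag_neq : forall j, (j < cq_len)%N -> cq_flag j != cq_flag j.+1;
  cq_descends : forall j, (j < cq_len)%N ->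
    descends (cq_flag j) (cq_flag j.+1) (cq_form j);
  cq_nondegenerate : forall j, (j < cq_len)%N ->
    nondegenerate (cq_flag j) (cq_flag j.+1) (cq_form j)
}.

(** Equality of points of the variety of complete quadrics. *)
Definition cq_eq (x y : complete_quadric) : Prop :=
  [/\ cq_len x = cq_len y,
      forall j, (j <= cq_len x)%N -> cq_flag x j = cq_flag y j &
      forall j, (j < cq_len x)%N ->
        same_quadric (cq_flag x j.+1) (cq_form x j) (cq_form y j)].

Lemma cq_eq_refl x : cq_eq x x.
Proof. by split=> // j _; exists 1 => [|w _]; rewrite ?oner_eq0 ?mul1r. Qed.

Lemma cq_eq_sym x y : cq_eq x y -> cq_eq y x.
Proof.
case=> e eV eQ; split=> // j; rewrite -e => lj; first by rewrite eV.
have [c c0 Hc] := eQ _ lj; exists c^-1; first by rewrite invr_eq0.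
by move=> w; rewrite -eV // => /Hc->; rewrite mulKf.
Qed.

Lemma cq_eq_trans x y z : cq_eq x y -> cq_eq y z -> cq_eq x z.
Proof.
case=> e eV eQ [e' eV' eQ']; split=> [|j lj|j lj]; first by rewrite e.
  by rewrite eV // eV' // -e.
have [c c0 Hc] := eQ _ lj; have [|d d0 Hd] := eQ' j; first by rewrite -e.
exists (c * d); first by rewrite mulf_neq0.
by move=> w Ww; rewrite Hc // Hd -?eV // mulrA.
Qed.

Definition move_space (g : 'M[k]_n) (U : {vspace V}) : {vspace V} :=
  (linfun (mulmx g) @: U)%VS.

(** The form [v |-> q (g^-1 v)], whose quadric is the image of that of [q]. *)
Definition move_form (g A : 'M[k]_n) : 'M[k]_n :=
  (invmx g)^T *m A *m invmx g.

Lemma qform_move g A v : qform (move_form g A) v = qform A (invmx g *m v).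
Proof. by rewrite /qform /move_form trmx_mul !mulmxA. Qed.

Lemma mem_move_space g U v :
  g \in unitmx -> (v \in move_space g U) = (invmx g *m v \in U).
Proof.
move=> gU; apply/idP/idP => [/memv_imgP[u uU ->]|vU].
  by rewrite lfunE /= mulKmx.
by apply/memv_imgP; exists (invmx g *m v); rewrite // lfunE /= mulKVmx.
Qed.

Section Action.

Variables (g : SL k n) (x : complete_quadric).

Let gU := SL_unit g.
Let flag j := move_space (val g) (cq_flag x j).
Let form j := move_form (val g) (cq_form x j).

Fact act_flag0 : flag 0 = 0%VS.
Proof. by rewrite /flag /move_space cq_flag0 limg0. Qed.

Fact act_flag_full : flag (cq_len x) = fullv.
Proof.
by apply/vspaceP=> v; rewrite mem_move_space // cq_flag_full !memvf.
Qed.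

Fact act_flag_sub j : (j < cq_len x)%N -> (flag j <= flag j.+1)%VS.
Proof. by move=> lj; apply: limgS; apply: cq_flag_sub. Qed.

Fact act_flag_neq j : (j < cq_len x)%N -> flag j != flag j.+1.
Proof.
move=> /cq_flag_neq; apply: contra_neq => /vspaceP e; apply/vspaceP=> v.
by have := e (val g *m v); rewrite !mem_move_space // mulKmx.
Qed.

Fact act_descends j :
  (j < cq_len x)%N -> descends (flag j) (flag j.+1) (form j).
Proof.
move=> lj u w; rewrite !mem_move_space // => Hu Hw.
by rewrite !qform_move mulmxDr (cq_descends lj).
Qed.

Fact act_nondegenerate j :
  (j < cq_len x)%N -> nondegenerate (flag j) (flag j.+1) (form j).
Proof.
move=> lj v; rewrite !mem_move_space // => Hv vP.
apply: (cq_nondegenerate lj) => // w Hw.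
have := vP (val g *m w); rewrite mem_move_space // mulKmx // => /(_ Hw).
by rewrite /polar !qform_move mulmxDr mulKmx.
Qed.

Definition act : complete_quadric :=
  CompleteQuadric act_flag0 act_flag_full act_flag_sub act_flag_neq
    act_descends act_nondegenerate.

End Action.

Lemma act_eq g x y : cq_eq x y -> cq_eq (act g x) (act g y).
Proof.
case=> e eV eQ; split=> //= j lj; first by rewrite eV.
have [c c0 Hc] := eQ _ lj; exists c => // w.
by rewrite mem_move_space ?SL_unit // !qform_move => /Hc.
Qed.

Lemma act_one x : cq_eq (act (SL_one k n) x) x.
Proof.
split=> //= j lj.
  by apply/vspaceP=> v; rewrite mem_move_space ?unitmx1 // invmx1 mul1mx.
exists 1 => [|w _]; first exact: oner_neq0.
by rewrite qform_move invmx1 mul1mx mul1r.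
Qed.

Lemma invmx_mul (g h : SL k n) :
  invmx (val g *m val h) = invmx (val h) *m invmx (val g).
Proof.
have ghU := SL_unit (SL_mul g h).
apply: (can_inj (mulKmx ghU)); rewrite mulmxV //= -mulmxA.
by rewrite (mulKVmx (SL_unit h)) (mulmxV (SL_unit g)).
Qed.

Lemma act_mul g h x : cq_eq (act (SL_mul g h) x) (act g (act h x)).
Proof.
have ghU := SL_unit (SL_mul g h).
split=> //= j lj.
  by apply/vspaceP=> v; rewrite !mem_move_space ?SL_unit // invmx_mul mulmxA.
exists 1 => [|w _]; first exact: oner_neq0.
by rewrite !qform_move invmx_mul mulmxA mul1r.
Qed.

Definition borel_orbit (x y : complete_quadric) : Prop :=
  exists2 b : SL k n, borel b & cq_eq y (act b x).

Definition torus_fixed (x : complete_quadric) : Prop :=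
  forall t : SL k n, torus t -> cq_eq (act t x) x.

End CompleteQuadrics.

Section MuInvolutions.

Variable n : nat.

Record composition := Composition {
  parts :> seq nat;
  parts_gt0 : all (fun m => 0 < m)%N parts;
  parts_sum : sumn parts = n
}.

(** The letters [1, ..., n] are represented by the ordinals [0, ..., n.-1]. *)
Definition alphabet (w : seq 'I_n) : seq 'I_n :=
  sort (fun a b : 'I_n => a <= b)%N w.

(** The permutation of [alphabet w] whose one-line notation is [w]. *)
Definition string_perm (w : seq 'I_n) (a : 'I_n) : 'I_n :=
  nth a w (index a (alphabet w)).

Definition string_involution (w : seq 'I_n) : bool :=
  all (fun a => string_perm w (string_perm w a) == a) w.

Record mu_involution (mu : composition) := MuInvolution {
  strings :> seq (seq 'I_n);
  strings_shape : shape strings = mu;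
  strings_perm : perm_eq (flatten strings) (enum 'I_n);
  strings_involution : all string_involution strings
}.

Definition barred (mu : composition) (pi : mu_involution mu) : bool :=
  all (fun m => m <= 2)%N mu &&
  all (fun w : seq 'I_n => if w is [:: j; i] then (i < j)%N else true) pi.

End MuInvolutions.

Section Distinguished.

Variables (k : fieldType) (char_neq2 : (2%:R : k) != 0).
Variables (n : nat) (mu : composition n) (pi : mu_involution mu).

Definition basis_vector (a : 'I_n) : 'cV[k]_n := delta_mx a 0.

Definition coord_space (s : seq 'I_n) : {vspace 'cV[k]_n} :=
  <<[seq basis_vector a | a <- s]>>%VS.

(** The sum of [x_a x_b] over the two-cycles [(a, b)] of [w] and of [x_c ^ 2]
    over its one-cycles [(c)]: see [qform_string]. *)
Definition string_form (w : seq 'I_n) : 'M[k]_n :=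
  \sum_(a <- w | (a < string_perm w a)%N) delta_mx a (string_perm w a) +
  \sum_(c <- w | string_perm w c == c) delta_mx c c.

Lemma qform_string (w : seq 'I_n) (v : 'cV[k]_n) :
  qform (string_form w) v =
    \sum_(a <- w | (a < string_perm w a)%N) v a 0 * v (string_perm w a) 0 +
    \sum_(c <- w | string_perm w c == c) v c 0 ^+ 2.
Proof.
have qd a b : (v^T *m delta_mx a b *m v) 0 0 = v a 0 * v b 0.
  rewrite -(mul_delta_mx (0 : 'I_1)) mulmxA -colE -mulmxA -rowE.
  by rewrite mxE big_ord1 !mxE.
rewrite /qform mulmxDr mulmxDl mxE; congr (_ + _).
  rewrite mulmx_sumr mulmx_suml summxE; apply: eq_bigr => a _; exact: qd.
rewrite mulmx_sumr mulmx_suml summxE; apply: eq_bigr => a _.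
by rewrite qd expr2.
Qed.

Lemma mem_coord_space (s : seq 'I_n) (v : 'cV[k]_n) :
  reflect (forall a, a \notin s -> v a 0 = 0) (v \in coord_space s).
Proof.
apply: (iffP idP) => [|H].
  rewrite /coord_space => vs a as_.
  rewrite (@coord_span _ _ _ (in_tuple (map basis_vector s)) v vs).
  rewrite summxE big1 // => i _; rewrite mxE.
  have /mapP[b bs ->] : (in_tuple (map basis_vector s))`_i
      \in map basis_vector s by apply: mem_nth.
  rewrite mxE; case: eqP => [e|]; last by rewrite mulr0.
  by rewrite e bs in as_.
rewrite [v]matrix_sum_delta; apply: memv_suml => a _; rewrite big_ord1.
case: (boolP (a \in s)) => [as_|/H->]; last by rewrite scale0r mem0v.
by apply: memvZ; apply: memv_span; apply: (map_f basis_vector).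
Qed.

Let flag j := coord_space (flatten (take j pi)).
Let form j := string_form (nth [::] pi j).

Lemma string_perm_mem (w : seq 'I_n) a : a \in w -> string_perm w a \in w.
Proof.
move=> aw; apply: mem_nth.
by rewrite -[X in (_ < X)%N](size_sort (fun a b : 'I_n => a <= b)%N) index_mem
  mem_sort.
Qed.

Lemma flag_stepE j : (j < size pi)%N ->
  flatten (take j.+1 pi) = flatten (take j pi) ++ nth [::] pi j.
Proof.
by move=> lj; rewrite (take_nth [::]) // -cats1 flatten_cat /= cats0.
Qed.

Lemma letters_disjoint j a : (j < size pi)%N ->
  a \in nth [::] pi j -> a \notin flatten (take j pi).
Proof.
move=> lj aj; have : uniq (flatten pi).
  by rewrite (perm_uniq (strings_perm pi)) enum_uniq.
rewrite -[X in flatten X](cat_take_drop j.+1) flatten_cat cat_uniq flag_stepE //.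
case/andP=> + _; rewrite cat_uniq => /and3P[_ + _].
by apply: contraNN => aj'; apply/hasP; exists a.
Qed.

Fact distinguished_flag0 : flag 0 = 0%VS.
Proof. by rewrite /flag take0 /coord_space span_nil. Qed.

Fact distinguished_flag_full : flag (size pi) = fullv.
Proof.
apply/vspaceP=> v; rewrite memvf; apply/mem_coord_space=> a.
by rewrite take_size (perm_mem (strings_perm pi)) mem_enum.
Qed.

Fact distinguished_flag_sub j :
  (j < size pi)%N -> (flag j <= flag j.+1)%VS.
Proof.
move=> lj; apply/subvP=> v /mem_coord_space Hv; apply/mem_coord_space=> a.
by rewrite flag_stepE // mem_cat negb_or => /andP[/Hv].
Qed.

Fact distinguished_flag_neq j : (j < size pi)%N -> flag j != flag j.+1.
Proof.
move=> lj; have : (0 < size (nth [::] pi j))%N.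
  rewrite -(nth_map _ 0%N) // -/(shape pi) (strings_shape pi).
  by apply: (allP (parts_gt0 mu)); apply: mem_nth; rewrite -(strings_shape pi) size_map.
case E: (nth [::] pi j) => [|a w] // _.
have aj : a \in nth [::] pi j by rewrite E mem_head.
apply/eqP=> /vspaceP/(_ (delta_mx a 0)).
have /mem_coord_space-> : forall b, b \notin flatten (take j.+1 pi) ->
    (delta_mx a 0 : 'cV[k]_n) b 0 = 0.
  move=> b; rewrite flag_stepE // mem_cat mxE; case: eqP => // ->.
  by rewrite aj orbT.
move/mem_coord_space/(_ a (letters_disjoint lj aj)).
by rewrite mxE !eqxx => /eqP; rewrite oner_eq0.
Qed.

Fact distinguished_descends j :
  (j < size pi)%N -> descends (flag j) (flag j.+1) (form j).
Proof.
move=> lj u w /mem_coord_space Hu _.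
have H a : a \in nth [::] pi j -> (w + u) a 0 = w a 0.
  by move=> aj; rewrite mxE Hu ?addr0 // letters_disjoint.
rewrite /form !qform_string; congr (_ + _).
  rewrite big_seq_cond [RHS]big_seq_cond.
  by apply: eq_bigr => a /andP[aj _]; rewrite !H ?string_perm_mem.
rewrite big_seq_cond [RHS]big_seq_cond.
by apply: eq_bigr => a /andP[aj _]; rewrite !H.
Qed.

Lemma polar_delta (A : 'M[k]_n) (v : 'cV[k]_n) (b : 'I_n) :
  polar A v (delta_mx b 0) = ((A + A^T) *m v) b 0.
Proof.
have tr1 (M : 'M[k]_1) : M 0 0 = M^T 0 0 by rewrite mxE.
set x := delta_mx b 0.
have -> : polar A v x = (v^T *m A *m x) 0 0 + (x^T *m A *m v) 0 0.
  have DE (M N : 'M[k]_1) : (M + N) 0 0 = M 0 0 + N 0 0 by rewrite mxE.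
  have TE : (v + x)^T = v^T + x^T by rewrite linearD.
  by rewrite /polar /qform TE !mulmxDl !mulmxDr !DE; ring.
have -> : (v^T *m A *m x) 0 0 = (A^T *m v) b 0.
  by rewrite tr1 !trmx_mul trmxK trmx_delta -rowE mxE.
have -> : (x^T *m A *m v) 0 0 = (A *m v) b 0.
  by rewrite trmx_delta -mulmxA -rowE mxE.
by rewrite addrC mulmxDl [RHS]mxE.
Qed.

Lemma sum_delta (w : seq 'I_n) (P : pred 'I_n) (F : 'I_n -> k) b :
  uniq w -> b \in w ->
  \sum_(a <- w | P a) (b == a)%:R * F a = if P b then F b else 0.
Proof.
move=> Uw bw; rewrite big_mkcond (bigD1_seq b) //= eqxx mul1r big1 ?addr0 //.
by move=> a ab; rewrite eq_sym (negbTE ab) mul0r if_same.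
Qed.

Lemma polar_string (w : seq 'I_n) (v : 'cV[k]_n) b :
  uniq w -> string_involution w -> b \in w ->
  polar (string_form w) v (basis_vector b) =
    (string_perm w b == b).+1%:R * v (string_perm w b) 0.
Proof.
move=> Uw /allP Iw bw; rewrite polar_delta.
set f := string_perm w.
have fK a : a \in w -> f (f a) = a by move=> aw; apply/eqP/Iw.
have fw a : a \in w -> f a \in w by apply: string_perm_mem.
have dE a c : (delta_mx a c *m v) b 0 = (b == a)%:R * v c 0.
  rewrite !mxE (bigD1 c) //= big1 ?addr0 => [|i /negbTE ic].
    by rewrite mxE eqxx andbT.
  by rewrite mxE ic andbF mul0r.
have DE (M N : 'M[k]_n) : ((M + N) *m v) b 0 = (M *m v) b 0 + (N *m v) b 0.
  by rewrite mulmxDl mxE.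
have SE (P : pred 'I_n) (h : 'I_n -> 'M[k]_n) :
    ((\sum_(a <- w | P a) h a) *m v) b 0 = \sum_(a <- w | P a) (h a *m v) b 0.
  by rewrite mulmx_suml summxE.
have TD (M N : 'M[k]_n) : (M + N)^T = M^T + N^T by rewrite linearD.
have TS (P : pred 'I_n) (h : 'I_n -> 'M[k]_n) :
    (\sum_(a <- w | P a) h a)^T = \sum_(a <- w | P a) (h a)^T.
  by rewrite linear_sum.
rewrite /string_form TD !TS !DE !SE -/f.
have E1 : \sum_(a <- w | (a < f a)%N) (delta_mx a (f a) *m v) b 0 =
    if (b < f b)%N then v (f b) 0 else 0.
  by under eq_bigr do rewrite dE; rewrite sum_delta.
have E2 : \sum_(a <- w | f a == a) (delta_mx a a *m v) b 0 =
    if f b == b then v b 0 else 0.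
  by under eq_bigr do rewrite dE; rewrite sum_delta.
have E3 : \sum_(a <- w | f a == a) ((delta_mx a a)^T *m v) b 0 =
    if f b == b then v b 0 else 0.
  by under eq_bigr do rewrite trmx_delta dE; rewrite sum_delta.
have E4 : \sum_(a <- w | (a < f a)%N) ((delta_mx a (f a))^T *m v) b 0 =
    if (f b < b)%N then v (f b) 0 else 0.
  under eq_bigr do rewrite trmx_delta dE.
  transitivity (\sum_(a <- w | (a < f a)%N) (f b == a)%:R * v a 0).
    rewrite big_seq_cond [RHS]big_seq_cond; apply: eq_bigr => a /andP[aw _].
    congr (_%:R * _); congr nat_of_bool.
    by apply/eqP/eqP => [->|<-]; rewrite fK.
  by rewrite sum_delta ?fw // fK.
rewrite E1 E2 E3 E4.
have [e|ne] := eqVneq (f b) b; first by rewrite !e ltnn /=; ring.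
have := ne; rewrite -val_eqE /= neq_ltn => /orP[] H; rewrite H.
  by rewrite ltnNge (ltnW H) /=; ring.
by rewrite ltnNge (ltnW H) /=; ring.
Qed.

Fact distinguished_nondegenerate j :
  (j < size pi)%N -> nondegenerate (flag j) (flag j.+1) (form j).
Proof.
move=> lj v /mem_coord_space Hv vP; apply/mem_coord_space=> a aj.
have [aw|aw] := boolP (a \in nth [::] pi j); last first.
  by apply: Hv; rewrite flag_stepE // mem_cat negb_or aj.
have Iw := allP (strings_involution pi) _ (mem_nth [::] lj).
have Uw : uniq (nth [::] pi j).
  have : uniq (flatten pi).
    by rewrite (perm_uniq (strings_perm pi)) enum_uniq.
  rewrite -[X in flatten X](cat_take_drop j.+1) flatten_cat cat_uniq.
  by rewrite flag_stepE // cat_uniq => /and3P[/and3P[]].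
set b := string_perm (nth [::] pi j) a.
have bw : b \in nth [::] pi j by apply: string_perm_mem.
have ba : string_perm (nth [::] pi j) b = a by apply/eqP/(allP Iw).
have bV : basis_vector b \in flag j.+1.
  apply/mem_coord_space=> c; rewrite flag_stepE // mem_cat mxE.
  by case: eqP => // ->; rewrite bw orbT.
have /eqP := vP _ bV; rewrite polar_string // ba mulf_eq0.
by case: (a == b) => /=; rewrite ?(negbTE char_neq2) ?oner_eq0 /= => /eqP.
Qed.

Definition distinguished : complete_quadric k n :=
  CompleteQuadric distinguished_flag0 distinguished_flag_full
    distinguished_flag_sub distinguished_flag_neq distinguished_descends
    distinguished_nondegenerate.

End Distinguished.

(* Main.v *)
(** A subspace stable under [T] is spanned by basis vectors; if it is [b U] with
    [b] in [B] and [U] spanned by basis vectors, it contains the leading vector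
    [e_a] of [b e_a] for every [e_a] in [U], hence equals [U].  So a torus-fixed
    point of the orbit has the same flag as [Q_pi].  On each successive quotient
    its quadric is a weight vector of [T], hence a single monomial, and
    nondegeneracy forces it to be [x_a ^ 2] or [x_a x_c], in dimension 1 or 2;
    triangularity of [b] rules out the string [ij] with [i < j], whose orbit
    consists of quadrics that do not vanish at [e_i]. *)
Require Import Defs.
From mathcomp Require Import all_boot all_order all_algebra.
From mathcomp Require Import ring.

Set Implicit Arguments.
Unset Strict Implicit.
Unset Printing Implicit Defensive.

Import GRing.Theory.
Local Open Scope ring_scope.

(** * Polar forms: bilinearity, expansion in coordinates, radical *)

Section Polar.

Variables (k : fieldType) (n : nat).
Implicit Types (A : 'M[k]_n) (u v w : 'cV[k]_n) (U W : {vspace 'cV[k]_n}).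

Lemma polarE A u v : polar A u v = (u^T *m (A + A^T) *m v) 0 0.
Proof.
have DE (M N : 'M[k]_1) : (M + N) 0 0 = M 0 0 + N 0 0 by rewrite mxE.
have tr1 (M : 'M[k]_1) : M 0 0 = M^T 0 0 by rewrite mxE.
have TE : (u + v)^T = u^T + v^T by rewrite linearD.
rewrite /polar /qform TE !(mulmxDl, mulmxDr, DE).
rewrite (tr1 (v^T *m A *m u)) !trmx_mul trmxK !mulmxA; ring.
Qed.

Lemma polarC A u v : polar A u v = polar A v u.
Proof. by rewrite /polar [v + u]addrC; ring. Qed.

Lemma polar_self A v : polar A v v = 2%:R * qform A v.
Proof.
have tr1 (M : 'M[k]_1) : M 0 0 = M^T 0 0 by rewrite mxE.
rewrite polarE mulmxDr mulmxDl mxE.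
rewrite [X in _ + X]tr1 !trmx_mul !trmxK mulmxA /qform; ring.
Qed.

Lemma polar0r A u : polar A u 0 = 0.
Proof. by rewrite polarE mulmx0 mxE. Qed.

Lemma polarDr A u v w : polar A u (v + w) = polar A u v + polar A u w.
Proof. by rewrite !polarE mulmxDr mxE. Qed.

Lemma polarZr A u c v : polar A u (c *: v) = c * polar A u v.
Proof. by rewrite !polarE -scalemxAr mxE. Qed.

Lemma polarZl A u c v : polar A (c *: u) v = c * polar A u v.
Proof. by rewrite polarC polarZr polarC. Qed.

Lemma polar_sumr A u (F : 'I_n -> 'cV[k]_n) :
  polar A u (\sum_a F a) = \sum_a polar A u (F a).
Proof. by apply: (big_morph _ (polarDr A u) (polar0r A u)). Qed.

Lemma polar_coordr A u v :
  polar A u v = \sum_a v a 0 * polar A u (basis_vector k a).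
Proof.
have {1}-> : v = \sum_a v a 0 *: basis_vector k a.
  by rewrite [LHS]matrix_sum_delta; apply: eq_bigr => a _; rewrite big_ord1.
by rewrite polar_sumr; apply: eq_bigr => a _; rewrite polarZr.
Qed.

Lemma polar_coordl A u v :
  polar A u v = \sum_a u a 0 * polar A (basis_vector k a) v.
Proof. by rewrite polarC polar_coordr; under eq_bigr do rewrite polarC. Qed.

Lemma descends_polar U W A u w : descends U W A ->
  u \in U -> w \in W -> polar A w u = 0.
Proof.
move=> dA uU wW; rewrite /polar dA //.
(* Descent at the zero vector shows that the form vanishes on [U]. *)
have := dA u 0 uU (mem0v W); rewrite add0r => ->.
by rewrite {3}/qform mulmx0 mxE; ring.
Qed.

(* [nondegenerate] alone is by now a notion of MathComp's sesquilinear forms. *)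
Lemma nondegenerate_coord U W A v : Defs.nondegenerate U W A ->
    (forall a, (basis_vector k a) \notin W -> forall w, w \in W -> w a 0 = 0) ->
    v \in W -> v \notin U ->
  exists2 a, basis_vector k a \in W & polar A v (basis_vector k a) != 0.
Proof.
move=> ndA coordW vW /negP vU.
case: (boolP [exists a, (basis_vector k a \in W)
                          && (polar A v (basis_vector k a) != 0)]).
  by case/existsP=> a /andP[]; exists a.
move/existsPn=> P; case: vU; apply: ndA => // w wW.
rewrite polar_coordr big1 // => a _; have := P a.
case: (boolP (_ \in W)) => /= [_ /negPn/eqP->|/coordW-> // _].
  by rewrite mulr0.
by rewrite mul0r.
Qed.

End Polar.

(** * Membership in coordinate subspaces *)

Section CoordSpace.

Variables (k : fieldType) (n : nat).
Implicit Types (s : seq 'I_n) (a : 'I_n).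

Lemma mem_basis_vector s a : (basis_vector k a \in coord_space k s) = (a \in s).
Proof.
apply/mem_coord_space/idP => [H|as_ b].
  by apply: contraT => /H/eqP; rewrite mxE !eqxx oner_eq0.
by rewrite mxE; case: eqP => // ->; rewrite as_.
Qed.

Lemma coord_space_support s a : basis_vector k a \notin coord_space k s ->
  forall w, w \in coord_space k s -> w a 0 = 0.
Proof. by rewrite mem_basis_vector => as_ w /mem_coord_space; apply. Qed.

End CoordSpace.

(** * Torus elements that separate coordinates *)

Section TorusElement.

Variables (k : fieldType) (n : nat) (a i : 'I_n) (s : k).
Hypotheses (s_neq0 : s != 0) (ai : a != i).

(** The entry [s^-1] at [i] compensates for [s] at [a], so that the diagonal matrix has determinant
    1. *)
Definition weight (c : 'I_n) : k :=
  if c == a then s else if c == i then s^-1 else 1.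

Lemma det_torus_elem : \det (diag_mx (\row_c weight c)) == 1.
Proof.
rewrite det_diag (bigD1 a) //= (bigD1 i) 1?eq_sym //= !mxE /weight !eqxx.
rewrite [i == a]eq_sym (negbTE ai) big1 ?mulr1 ?divff // => c /andP[ca ci].
by rewrite mxE /weight (negbTE ca) (negbTE ci).
Qed.

Definition torus_elem : SL k n :=
  exist (fun g : 'M[k]_n => is_true (\det g == 1)) _ det_torus_elem.

Lemma torus_torus_elem : torus torus_elem.
Proof. exact: diag_mx_is_diag. Qed.

Lemma torus_elemE (v : 'cV[k]_n) c : (val torus_elem *m v) c 0 = weight c * v c 0.
Proof. by rewrite mul_diag_mx !mxE. Qed.

Lemma torus_elem_basis c :
  val torus_elem *m basis_vector k c = weight c *: basis_vector k c.
Proof.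
apply/colP=> d; rewrite torus_elemE !mxE.
by case: eqP => [->|]; rewrite ?mulr0.
Qed.

End TorusElement.

(** 12 is the least common multiple of 1, 2, 3 and 4, the exponents [m] for which [s ^+ m = 1] has
    to be excluded when weights are compared below. A closed field has a non-root of the nonzero
    polynomial ['X^13 - 'X]. *)
Lemma exists_non_root_of_unity (k : closedFieldType) :
  exists2 s : k, s != 0 & s ^+ 12 != 1.
Proof.
have : 'X^13 - 'X != 0 :> {poly k}.
  apply/eqP=> /(congr1 (fun p : {poly k} => p`_13)) /eqP.
  by rewrite coefB coefXn coefX coef0 /= subr0 oner_eq0.
case/closed_nonrootP=> s; rewrite rootE !hornerE subr_eq0 exprSr => H; exists s.
  by apply: contraNneq H => ->; rewrite mulr0.
by apply: contraNneq H => ->; rewrite mul1r.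
Qed.

(** * Subspaces stable under the torus *)

Section TorusStable.

Variables (k : closedFieldType) (n : nat).

(** Let [t] have weight [s] at [a], [s^-1] at [c] and 1 elsewhere. Then [t - 1] kills all
    coordinates but [a] and [c], and [t - s^-1] kills that at [c]; their product is a nonzero
    multiple of the projection to the line of [e_a]. *)
Lemma torus_stable_coord (U : {vspace 'cV[k]_n}) v a :
    (forall t : SL k n, torus t -> move_space (val t) U = U) ->
  v \in U -> v a 0 *: basis_vector k a \in U.
Proof.
move=> tU vU; have mU t w : torus t -> w \in U -> val t *m w \in U.
  by move=> tt wU; rewrite -(tU t tt) mem_move_space ?SL_unit // mulKmx ?SL_unit.
(* If [a] is the only index, the torus is trivial, but [v] is already a multiple of [e_a]. *)
have [|/pred0Pn[c]] := boolP (pred0b (predC1 a)).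
  move=> /pred0P n1; congr (_ \in U): vU; apply/colP=> b; rewrite !mxE.
  by have := n1 b; rewrite /= => /negbFE/eqP->; rewrite eqxx mulr1.
rewrite /= eq_sym => ac; have [s s0 s12] := exists_non_root_of_unity k.
pose t := torus_elem s0 ac; have tt : torus t by apply: torus_torus_elem.
pose w := val t *m v - v; have wU : w \in U by rewrite memvB ?mU.
have : val t *m w - s^-1 *: w \in U by rewrite memvB ?mU // memvZ.
have s2 : s - s^-1 != 0.
  apply: contraNneq s12 => /eqP; rewrite subr_eq0 => /eqP e.
  by rewrite (exprM s 2 6) expr2 {1}e mulVf // expr1n.
have s1 : s - 1 != 0.
  by apply: contraNneq s12 => /eqP; rewrite subr_eq0 => /eqP->; rewrite expr1n.
have -> : val t *m w - s^-1 *: w =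
    ((s - s^-1) * (s - 1)) *: (v a 0 *: basis_vector k a).
  apply/colP=> b; rewrite /w !(torus_elemE, mxE).
  rewrite /weight; case: eqP => [->|_] /=; first ring.
  by case: eqP => [->|_] /=; ring.
move/(memvZ ((s - s^-1) * (s - 1))^-1).
by rewrite scalerA mulVf ?scale1r // mulf_neq0.
Qed.

(** By dimension it suffices that each [e_a] with [a] in [s] lies in the translate. The coordinate
    of [b e_a] at [a] is a diagonal entry of [b], nonzero because [b] is triangular and
    invertible. *)
Lemma torus_stable_borel_coord (b : SL k n) s :
    borel b ->
    (forall t : SL k n, torus t ->
      move_space (val t) (move_space (val b) (coord_space k s))
        = move_space (val b) (coord_space k s)) ->
  move_space (val b) (coord_space k s) = coord_space k s.
Proof.
move=> bB tU; apply/esym/eqP; rewrite eqEdim; apply/andP; split; last first.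
  by rewrite -(limg_ker_dim (linfun (mulmx (val b))) (coord_space k s)) leq_addl.
apply/span_subvP=> _ /mapP[a as_ ->].
have := @torus_stable_coord _ (val b *m basis_vector k a) a tU.
rewrite mem_move_space ?SL_unit // mulKmx ?SL_unit // mem_basis_vector as_.
have -> : (val b *m basis_vector k a) a 0 = val b a a.
  by rewrite -colE mxE.
move=> /(_ isT)/(memvZ (val b a a)^-1); rewrite scalerA mulVf ?scale1r //.
have : \det (val b)^T != 0 by rewrite det_tr (eqP (valP b)) oner_eq0.
by rewrite det_trig // prodf_seq_neq0 => /allP/(_ a (mem_index_enum a)); rewrite mxE.
Qed.

End TorusStable.

(** * Action of the torus on coordinates and coordinate subspaces *)

Section TorusAction.

Variables (k : fieldType) (n : nat) (t : SL k n).
Hypothesis tT : torus t.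

Lemma torusE (v : 'cV[k]_n) a : (val t *m v) a 0 = val t a a * v a 0.
Proof.
rewrite mxE (bigD1 a) //= big1 ?addr0 // => c ca.
by rewrite (is_diag_mxP tT) ?mul0r // eq_sym.
Qed.

Lemma torus_diag_neq0 a : val t a a != 0.
Proof.
have : \det (val t) != 0 by rewrite (eqP (valP t)) oner_eq0.
rewrite det_trig ?is_diag_mx_is_trig //.
by rewrite prodf_seq_neq0 => /allP/(_ a (mem_index_enum a)).
Qed.

Lemma torus_coord_space (s : seq 'I_n) :
  move_space (val t) (coord_space k s) = coord_space k s.
Proof.
apply/vspaceP=> v; rewrite mem_move_space ?SL_unit //.
rewrite -{2}[v](mulKVmx (SL_unit t)); move: (_ *m v) => u.
apply/mem_coord_space/mem_coord_space => H a /H.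
  by rewrite torusE => ->; rewrite mulr0.
by rewrite torusE => /eqP; rewrite mulf_eq0 (negbTE (torus_diag_neq0 a)) => /eqP.
Qed.

End TorusAction.

(** * Strings with one or two letters and their forms *)

Section Strings.

Variables (k : fieldType) (n : nat).

Lemma string_perm1 (a : 'I_n) : string_perm [:: a] a = a.
Proof. by rewrite /string_perm /= eqxx. Qed.

Lemma string_perm_id (i j : 'I_n) : (i < j)%N -> string_perm [:: i; j] i = i.
Proof. by move=> ij; rewrite /string_perm /alphabet /sort /= (ltnW ij) /= eqxx. Qed.

Lemma string_perm_swapl (i j : 'I_n) : (i < j)%N -> string_perm [:: j; i] j = i.
Proof.
move=> ij; rewrite /string_perm /alphabet /sort /= leqNgt ij /=.
by rewrite -val_eqE /= (ltn_eqF ij) eqxx.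
Qed.

Lemma string_perm_swapr (i j : 'I_n) : (i < j)%N -> string_perm [:: j; i] i = j.
Proof. by move=> ij; rewrite /string_perm /alphabet /sort /= leqNgt ij /= eqxx. Qed.

Lemma qform_string1 (a : 'I_n) (v : 'cV[k]_n) :
  qform (string_form k [:: a]) v = v a 0 ^+ 2.
Proof.
by rewrite qform_string !big_cons !big_nil string_perm1 ltnn eqxx add0r addr0.
Qed.

Lemma qform_string_swap (i j : 'I_n) (v : 'cV[k]_n) : (i < j)%N ->
  qform (string_form k [:: j; i]) v = v i 0 * v j 0.
Proof.
move=> ij; rewrite qform_string !big_cons !big_nil.
rewrite string_perm_swapl // string_perm_swapr // ij ltnNge (ltnW ij) /=.
by rewrite -!val_eqE /= (ltn_eqF ij) (gtn_eqF ij) !addr0.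
Qed.

End Strings.

(** * Torus-fixed quadrics on one successive quotient *)

Section FixedPiece.

Variables (k : closedFieldType) (n : nat) (s w : seq 'I_n) (A : 'M[k]_n).

Local Notation U := (coord_space k s).
Local Notation W := (coord_space k (s ++ w)).
Local Notation e := (basis_vector k).

Hypotheses (dA : descends U W A) (ndA : Defs.nondegenerate U W A).
Hypothesis tA :
  forall t : SL k n, torus t -> same_quadric W (move_form (val t) A) A.
Hypothesis uniq_sw : uniq (s ++ w).

(** Since the form descends, [U] lies in the radical of its polar form on [W]. *)
Lemma polar_radical a c :
  a \in s ++ w -> c \in s ++ w -> polar A (e a) (e c) != 0 -> (a \in w) && (c \in w).
Proof.
move=> asw csw; move: (asw) (csw); rewrite !mem_cat; case: (a \in w) => /=; last first.
  rewrite orbF => as_ _.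
  by rewrite polarC (descends_polar dA) ?eqxx // mem_basis_vector.
case: (c \in w) => //=; rewrite orbF => _ cs.
by rewrite (descends_polar dA) ?eqxx // mem_basis_vector.
Qed.

(** Nondegeneracy is applied to [e_a], which lies in [W] but not in [U] because the letters are
    distinct. *)
Lemma polar_partner a : a \in w ->
  exists2 c, c \in w & polar A (e a) (e c) != 0.
Proof.
move=> aw; have asw : a \in s ++ w by rewrite mem_cat aw orbT.
have as_ : a \notin s.
  by move: uniq_sw; rewrite cat_uniq => /and3P[_ /hasPn/(_ a aw)].
have [||c] := nondegenerate_coord ndA (@coord_space_support k n (s ++ w)) (v := e a).
- by rewrite mem_basis_vector.
- by rewrite mem_basis_vector.
rewrite mem_basis_vector => csw ac; exists c => //.
by have /andP[] := polar_radical asw csw ac.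
Qed.

(* The torus acts on [x_a x_c] with weight [e_a + e_c], so all monomials that
   occur in a fixed quadric have the same weight. *)
Lemma fixed_weight i l a c :
    {subset [:: i; l; a; c] <= s ++ w} ->
    polar A (e i) (e l) != 0 -> polar A (e a) (e c) != 0 ->
  a \in [:: i; l].
Proof.
move=> sub il ac; apply: contraT; rewrite !inE negb_or => /andP[ai al].
have [x x0 x12] := exists_non_root_of_unity k.
pose t := torus_elem x0 ai.
have [d d0 Hd] := tA (torus_torus_elem x0 ai : torus t).
have qE v : v \in W -> qform A v = d * qform A (val t *m v).
  move=> vW; rewrite -Hd; first by rewrite qform_move mulKmx ?SL_unit.
  rewrite -(torus_coord_space (torus_torus_elem x0 ai : torus t)).
  by rewrite mem_move_space ?SL_unit // mulKmx ?SL_unit.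
have pE u v : u \in W -> v \in W ->
    polar A u v = d * polar A (val t *m u) (val t *m v).
  move=> uW vW; rewrite /polar (qE _ (memvD uW vW)) (qE _ uW) (qE _ vW) mulmxDr; ring.
have wE b b' : b \in s ++ w -> b' \in s ++ w -> polar A (e b) (e b') != 0 ->
    d * (weight a i x b * weight a i x b') = 1.
  move=> bw b'w bb'; apply: (mulIf bb'); rewrite mul1r.
  rewrite [RHS]pE ?mem_basis_vector // !torus_elem_basis polarZl polarZr; ring.
have [] : [/\ i \in s ++ w, l \in s ++ w, a \in s ++ w & c \in s ++ w].
  by split; apply: sub; rewrite !inE eqxx ?orbT.
move=> iW lW aW cW.
have := wE _ _ iW lW il; rewrite -(wE _ _ aW cW ac) => /(mulfI d0).
rewrite /weight eqxx [i == a]eq_sym (negbTE ai) eqxx [l == a]eq_sym (negbTE al).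
have powx m : x ^+ m = 1 -> (m %| 12)%N -> false.
  by move=> xm /dvdnP[q m12]; rewrite m12 mulnC exprM xm expr1n eqxx in x12.
(* The two monomials have equal weight, [weight i * weight l = weight a * weight c]. In each case
   this reads [x ^+ m = 1] with [m] at most 4. *)
case: (l == i); [case: (c == a); last case: (c == i)|
                 case: (c == a); last case: (c == i)] => eq.
- apply: (powx 4) => //; transitivity (x ^+ 2 * (x * x)); first ring.
  by rewrite -eq; field.
- apply: (powx 2) => //; transitivity (x ^+ 2 * (x * x^-1)); first by field.
  by rewrite -eq; field.
- apply: (powx 3) => //; transitivity (x ^+ 2 * (x * 1)); first ring.
  by rewrite -eq; field.
- apply: (powx 3) => //; transitivity (x * (x * x)); first ring.
  by rewrite -eq; field.
- apply: (powx 1%N) => //; transitivity (x * (x * x^-1)); first by field.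
  by rewrite -eq; field.
- apply: (powx 2) => //; transitivity (x * (x * 1)); first ring.
  by rewrite -eq; field.
Qed.

(** Every letter has a partner, so it occurs in some monomial of the quadric, and [fixed_weight]
    applies to that monomial. This bounds the dimension of the quotient by 2. *)
Lemma fixed_letters i l : i \in w -> l \in w -> polar A (e i) (e l) != 0 ->
  {subset w <= [:: i; l]}.
Proof.
move=> iw lw il a aw; have [c cw ac] := polar_partner aw.
apply: fixed_weight il ac => b; rewrite !inE mem_cat => H; apply/orP; right.
by case/or4P: H => /eqP->.
Qed.

(** Twice the form is the polar form on the diagonal, and basis vectors outside [w] contribute
    nothing to its expansion. *)
Lemma qform_piece v : v \in W ->
  2%:R * qform A v =
    \sum_(a <- w) \sum_(c <- w) v a 0 * (v c 0 * polar A (e a) (e c)).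
Proof.
move=> vW.
have uw : uniq w by move: uniq_sw; rewrite cat_uniq => /and3P[].
have supp (F : 'I_n -> k) : (forall a, a \notin w -> F a = 0) ->
    \sum_a F a = \sum_(a <- w) F a.
  move=> F0; rewrite (big_uniq _ uw) [RHS]big_mkcond; apply: eq_bigr => a _.
  by case: ifPn => // /F0.
have vsw a : a \notin s ++ w -> v a 0 = 0 by move/mem_coord_space: vW; apply.
have rad a c : (a \notin w) || (c \notin w) ->
    v a 0 * (v c 0 * polar A (e a) (e c)) = 0.
  move=> H; have [asw|/vsw->] := boolP (a \in s ++ w); last by rewrite mul0r.
  have [csw|/vsw->] := boolP (c \in s ++ w); last by rewrite mul0r mulr0.
  have [->|/(polar_radical asw csw)] := eqVneq (polar A (e a) (e c)) 0.
    by rewrite !mulr0.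
  by rewrite -[_ && _]negbK negb_and H.
rewrite -polar_self polar_coordl supp => [|a aw].
  apply: eq_bigr => a _; rewrite polar_coordr mulr_sumr supp // => c cw.
  by rewrite rad // cw orbT.
by rewrite polar_coordr mulr_sumr big1 // => c _; rewrite rad // aw.
Qed.

Lemma fixed_piece1 a : (2%:R : k) != 0 -> w = [:: a] ->
  same_quadric W A (string_form k w).
Proof.
move=> k2 wE; have [|c cw ac] := @polar_partner a; first by rewrite wE mem_head.
move: cw; rewrite {1}wE inE => /eqP ca; rewrite ca in ac.
(* This constant is the value of the form at [e_a]. *)
exists (2%:R^-1 * polar A (e a) (e a)); first by rewrite mulf_neq0 ?invr_eq0.
move=> v vW; apply: (mulfI k2); rewrite qform_piece // wE qform_string1.
by rewrite !big_seq1; field.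
Qed.

(** A square term in one letter would, by [fixed_letters], make it the only letter; hence just the
    mixed term is left. *)
Lemma fixed_piece_swap (i j : 'I_n) : (2%:R : k) != 0 -> (i < j)%N -> w = [:: j; i] ->
  same_quadric W A (string_form k w).
Proof.
move=> k2 ij wE; have iw : i \in w by rewrite wE !inE eqxx orbT.
have jw : j \in w by rewrite wE mem_head.
have ij' : i != j by rewrite -val_eqE /= (ltn_eqF ij).
have pii : polar A (e i) (e i) = 0.
  apply/eqP; apply: contraT => /(fixed_letters iw iw)/(_ j jw).
  by rewrite !inE eq_sym (negbTE ij').
have pjj : polar A (e j) (e j) = 0.
  apply/eqP; apply: contraT => /(fixed_letters jw jw)/(_ i iw).
  by rewrite !inE (negbTE ij').
exists (polar A (e i) (e j)) => [|v vW].
  have [c] := polar_partner iw; rewrite {1}wE !inE => /orP[]/eqP-> //.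
  by rewrite pii eqxx.
apply: (mulfI k2); rewrite qform_piece // wE qform_string_swap //.
rewrite !big_cons !big_nil pii pjj (polarC A (e j)); ring.
Qed.

(* Take for [i] the least letter of [w] and for [c] its partner. As [b] is
   triangular, the nonzero value of the polar form at [(b e_i, b e_c)] comes
   from some [(e_i, e_l)] with [l <= c]; then [w] has no letters besides [i]
   and [l], and [w] is not [:: i; l], for which [c] would be [i]. *)
Lemma fixed_string (b : SL k n) :
    (2%:R : k) != 0 -> borel b -> move_space (val b) W = W ->
    same_quadric W A (move_form (val b) (string_form k w)) ->
    string_involution w -> w != [::] ->
  (size w <= 2)%N && (if w is [:: j; i] then (i < j)%N else true).
Proof.
move=> k2 bB bW [d d0 Hd] invw w0.
have uw : uniq w by move: uniq_sw; rewrite cat_uniq => /and3P[].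
have [i0 i0w] : exists i0, i0 \in w.
  by case: (w) w0 => // a w' _; exists a; rewrite mem_head.
case: (arg_minnP (fun a : 'I_n => nat_of_ord a) i0w) => i iw imin.
pose c := string_perm w i; have cw : c \in w by apply: string_perm_mem.
have ci : string_perm w c = i by apply/eqP/(allP invw).
have ew a : a \in w -> e a \in W by move=> aw; rewrite mem_basis_vector mem_cat aw orbT.
have bWm u : u \in W -> val b *m u \in W.
  by move=> uW; rewrite -bW mem_move_space ?SL_unit // mulKmx ?SL_unit.
(* Up to the factor [d], this is the polar form of the string at partners, namely 1, or 2 if [c] is
   [i]. *)
have pb : polar A (val b *m e i) (val b *m e c) != 0.
  rewrite /polar -mulmxDr !Hd ?bWm ?memvD ?ew // !qform_move !mulKmx ?SL_unit //.
  rewrite -!mulrBr mulf_neq0 // -/(polar _ _ _) polar_string // ci.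
  by rewrite mxE !eqxx mulr1; case: (i == c) => //; apply: oner_neq0.
have bE a a' : (val b *m e a) a' 0 = val b a' a by rewrite -colE mxE.
have supp a a' : a \in w -> val b a' a != 0 -> (a' <= a)%N && (a' \in s ++ w).
  move=> aw ba; apply/andP; split.
    rewrite leqNgt; apply: contraNN ba => lt.
    by have := is_trig_mxP bB a a' lt; rewrite mxE => ->.
  apply: contraNT ba => a'sw; rewrite -bE.
  by move/mem_coord_space: (bWm _ (ew _ aw)) => ->.
have sumP (F : 'I_n -> k) : \sum_a F a != 0 -> exists a, F a != 0.
  move=> F0; apply/existsP; apply: contraNT F0 => /existsPn F0.
  by rewrite big1 // => a _; apply/eqP/negPn/F0.
move: pb; rewrite polar_coordl => /sumP[a]; rewrite bE mulf_eq0 negb_or.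
case/andP=> /(supp _ _ iw)/andP[ai asw].
rewrite polar_coordr => /sumP[l]; rewrite bE mulf_eq0 negb_or.
case/andP=> /(supp _ _ cw)/andP[lc lsw] al.
have /andP[aw lw] := polar_radical asw lsw al.
have {}ai : a = i by apply/val_inj/eqP; rewrite eqn_leq ai imin.
rewrite {}ai in al aw asw.
have sub := fixed_letters iw lw al.
rewrite (uniq_leq_size uw sub) /=.
have nil : (i < l)%N -> w != [:: i; l].
  move=> il; apply: contraTneq lc => wE.
  by rewrite /c wE string_perm_id // -ltnNge.
move: uw iw sub imin nil; case: (w) => [|y [|z [|? ?]]] //=.
rewrite !(inE, andbT, orbF) => yz /orP[]/eqP iE sub imin nil; rewrite -iE in sub imin nil yz *.
  have zl : z = l.
    apply/eqP; have := sub z; rewrite !inE eqxx orbT => /(_ isT).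
    by rewrite eq_sym (negbTE yz).
  have il : (i < l)%N.
    rewrite ltn_neqAle -zl; apply/andP; split=> //.
    by apply: imin; rewrite eqxx orbT.
  by have := nil il; rewrite zl eqxx.
rewrite ltn_neqAle eq_sym; apply/andP; split=> //.
by apply: imin; rewrite eqxx.
Qed.

End FixedPiece.

(** * Fixed points in the orbit of the distinguished quadric *)

Section Orbit.

Variables (k : closedFieldType) (k2 : (2%:R : k) != 0).
Variables (n : nat) (mu : composition n) (pi : mu_involution mu).
Local Notation Q := (distinguished k2 pi).
Local Notation prefix j := (flatten (take j pi)).
Local Notation string j := (nth [::] pi j).

Lemma uniq_prefix_string j : (j < size pi)%N -> uniq (prefix j ++ string j).
Proof.
move=> lj; have : uniq (flatten pi).
  by rewrite (perm_uniq (strings_perm pi)) enum_uniq.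
rewrite -[X in flatten X](cat_take_drop j.+1) flatten_cat cat_uniq.
by rewrite flag_stepE // => /andP[].
Qed.

Lemma string_neq_nil j : (j < size pi)%N -> string j != [::].
Proof.
move=> lj; rewrite -size_eq0 -lt0n -(nth_map _ 0%N) // -/(shape pi).
rewrite strings_shape; apply: (allP (parts_gt0 mu)); apply: mem_nth.
by rewrite -(strings_shape pi) size_map.
Qed.

(** [barred] tests lengths on [mu] and order on the strings; the shape of [pi] merges both into one
    condition per string. *)
Lemma barredP : reflect
  (forall j, (j < size pi)%N -> (size (string j) <= 2)%N &&
     (if string j is [:: b; a] then (a < b)%N else true))
  (barred pi).
Proof.
rewrite /barred -(strings_shape pi) all_map -all_predI.
exact: (iffP (all_nthP [::])).
Qed.

Section FixedPoint.

Variables (x : complete_quadric k n) (b : SL k n).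
Hypotheses (bB : borel b) (xE : cq_eq x (act b Q)) (xT : torus_fixed x).

Lemma fixed_flag j : (j <= size pi)%N ->
  move_space (val b) (coord_space k (prefix j)) = coord_space k (prefix j) /\
  cq_flag x j = coord_space k (prefix j).
Proof.
case: xE => /= xl xV _; rewrite -xl => lj; have xj := xV j lj; rewrite xj.
suff -> : move_space (val b) (coord_space k (prefix j)) = coord_space k (prefix j).
  by [].
apply: torus_stable_borel_coord => // t tT; rewrite -xj.
by case: (xT tT) => _ /(_ j lj).
Qed.

(** Once the flag of [x] is known to be the coordinate flag, the results on a single quotient apply
    to each piece of [x]. *)
Lemma fixed_pieceE j : (j < size pi)%N ->
  let U := coord_space k (prefix j) in
  let W := coord_space k (prefix j ++ string j) in
  [/\ descends U W (cq_form x j), Defs.nondegenerate U W (cq_form x j),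
      forall t : SL k n, torus t ->
        same_quadric W (move_form (val t) (cq_form x j)) (cq_form x j),
      move_space (val b) W = W &
      same_quadric W (cq_form x j) (move_form (val b) (string_form k (string j)))].
Proof.
move=> lj U W; case: xE => /= xl _ /(_ j); rewrite xl => /(_ lj) xQ.
have [_ xU] := fixed_flag (ltnW lj).
have [bW xW] := fixed_flag lj; rewrite flag_stepE // in bW xW.
have lx : (j < cq_len x)%N by rewrite xl.
split=> //; first by rewrite /U /W -xU -xW; apply: cq_descends.
- by rewrite /U /W -xU -xW; apply: cq_nondegenerate.
- move=> t tT; have [_ _ /(_ j lx)] := xT tT.
  by rewrite /= xW torus_coord_space //.
- by rewrite /W -xW.
Qed.

Lemma fixed_barred : barred pi.
Proof.
apply/barredP=> j lj; have [dA ndA tA bW xQ] := fixed_pieceE lj.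
apply: (fixed_string dA ndA tA (uniq_prefix_string lj) k2 bB bW xQ).
  exact: (allP (strings_involution pi)) (mem_nth _ _).
exact: string_neq_nil.
Qed.

(** As [pi] is barred, each string is one letter or a descending pair, where the fixed quadric is
    determined up to a scalar. *)
Lemma fixed_distinguished : cq_eq x Q.
Proof.
have xl : cq_len x = size pi by case: xE.
split=> //= j; rewrite xl => lj; first by have [] := fixed_flag lj.
have [dA ndA tA _ _] := fixed_pieceE lj.
have [_ ->] := fixed_flag lj; rewrite flag_stepE //.
have uq := uniq_prefix_string lj.
have := barredP fixed_barred j lj; have := string_neq_nil lj.
case wE: (string j) => [|c [|a [|? ?]]] //= _ ac; rewrite -wE.
  exact: (fixed_piece1 dA ndA uq k2 wE).
exact: (fixed_piece_swap dA ndA tA uq k2 ac wE).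
Qed.

End FixedPoint.

(** The form of a barred string is a monomial, which [t] rescales by the inverse of its weight since
    the form is evaluated at [t^-1 v]. *)
Lemma barred_torus_fixed : barred pi -> torus_fixed Q.
Proof.
move=> pib t tT; split=> //= j lj; first exact: torus_coord_space.
have := barredP pib j lj; have := string_neq_nil lj.
have t0 a := torus_diag_neq0 tT a.
case: (string j) => [|c [|a [|? ?]]] //= _ ac.
  exists (val t c c ^- 2); first by rewrite invr_eq0 expf_neq0.
  move=> v _; rewrite qform_move -{2}[v](mulKVmx (SL_unit t)).
  by rewrite !qform_string1 torusE // exprMn mulKf // expf_neq0.
exists (val t a a * val t c c)^-1; first by rewrite invr_eq0 mulf_neq0.
move=> v _; rewrite qform_move -{2}[v](mulKVmx (SL_unit t)).
by rewrite !qform_string_swap // !torusE // mulrACA mulKf // mulf_neq0.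
Qed.

End Orbit.

Theorem proposition4p5 (k : closedFieldType) (char_neq2 : (2%:R : k) != 0)
    (n : nat) (mu : composition n) (pi : mu_involution mu) :
  ((exists x : complete_quadric k n,
      borel_orbit (distinguished char_neq2 pi) x /\ torus_fixed x) <->
   barred pi) /\
  (barred pi ->
   forall x : complete_quadric k n,
     (borel_orbit (distinguished char_neq2 pi) x /\ torus_fixed x) <->
     cq_eq x (distinguished char_neq2 pi)).
Proof.
(* Points are compared by [cq_eq], so the identity of [B] serves as witness. *)
have orbitQ x : cq_eq x (distinguished char_neq2 pi) ->
    borel_orbit (distinguished char_neq2 pi) x.
  move=> xQ; exists (SL_one k n).
    by rewrite /borel /= trmx1 scalar_mx_is_trig.
  exact: cq_eq_trans xQ (cq_eq_sym (act_one _)).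
split=> [|pib x].
  split=> [[x [[b bB xE] xT]]|pib]; first exact: fixed_barred bB xE xT.
  exists (distinguished char_neq2 pi); split; last exact: barred_torus_fixed.
  exact/orbitQ/cq_eq_refl.
split=> [[[b bB xE] xT]|xQ]; first exact: fixed_distinguished bB xE xT.
split=> [|t tT]; first exact: orbitQ.
apply: cq_eq_trans (act_eq t xQ) _.
exact: cq_eq_trans (barred_torus_fixed char_neq2 pib tT) (cq_eq_sym xQ).
Qed.
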